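(* Let $M$ be a ${\rm II}_1$-factor acting on $H=L^2(M,\tau)$, let $\{z_n\}_{n=1}^\infty\in\mathfrak S$, let $\phi=\sum_{n=1}^\infty \mathrm{Ad}\,Jz_nJ$, and let $P\subseteq M$ be the von Neumann algebra generated by $\{z_n\}_{n=1}^\infty$. Then $$M'\cap B(H)^{\phi}=M'\cap\langle M,e_P\rangle=J(P'\cap M)J.$$
   Context: $\tau$ is the unique tracial state of $M$, $\xi_0\in H=L^2(M,\tau)$ is the cyclic trace unit vector, and $J$ is the modular conjugation on $H$, $Jx\xi_0=x^*\xi_0$ for $x\in M$, so $M'=JMJ$ (commutants are taken in $B(H)$). For $a\in B(H)$, $\mathrm{Ad}\,a(T)=aTa^*$. Infinite sums are in the strong operator topology (pointwise for sums of maps). $\mathfrak S$ is the set of sequences $\{z_n\}_{n=1}^\infty$ in $M$ with $\sum_n z_nz_n^*=\sum_n z_n^*z_n=1$ such that for each $n$ there is $k$ with $z_n^*=z_k$. For such a sequence, $\phi(T)=\sum_n Jz_nJ\,T\,Jz_n^*J$ is a unital normal completely positive map on $B(H)$ with $\phi=\mathrm{id}$ on $M$. $B(H)^\phi=\{T\in B(H):\phi(T)=T\}$. $e_P$ is the Jones projection, i.e. the orthogonal projection of $H$ onto $L^2(P,\tau)$, and $\langle M,e_P\rangle=(JPJ)'$ is the Jones basic extension. One has $P\subseteq M\subseteq\langle M,e_P\rangle\subseteq B(H)^\phi$. *)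

(* Defs.v *)
From HB Require Import structures.
From mathcomp Require Import all_boot all_order all_algebra.
From mathcomp Require Import complex.
From mathcomp Require Import all_classical all_reals all_analysis.
Import Order.TTheory GRing.Theory Num.Theory.
Import numFieldNormedType.Exports.

Set Implicit Arguments.
Unset Strict Implicit.
Unset Printing Implicit Defensive.

Local Open Scope classical_set_scope.
Local Open Scope complex_scope.
Local Open Scope ring_scope.

(* A complex Hilbert space is a complete normed space H over R[i] together with
   an inner product ip : {dot H for Num.conj} (linear in its first argument)
   such that hilbert ip holds.  Operators on H are plain functions H -> H, so
   that the product of a and b is a \o b and equality is pointwise. *)

Definition hilbert (R : realType) (H : completeNormedModType R[i])
    (ip : {dot H for Num.conj}) : Prop :=
  forall u : H, `|u| ^+ 2 = ip u u.

Section Operators.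
Context {R : realType} {H : completeNormedModType R[i]}.
Variable ip : {dot H for Num.conj}.

Definition BH : set (H -> H) := [set T | linear T /\ continuous T].

(* By the Riesz theorem there is exactly one such S when T is in BH; the value
   for other T is irrelevant. *)
Definition adj (T : H -> H) : H -> H :=
  get [set S | BH S /\ forall u v : H, ip (T u) v = ip u (S v)].

Definition Ad (a T : H -> H) : H -> H := a \o T \o adj a.

Definition commutant (S : set (H -> H)) : set (H -> H) :=
  [set T | BH T /\ forall s, S s -> T \o s = s \o T].

Definition von_neumann (M : set (H -> H)) : Prop :=
  (forall x, M x -> M (adj x)) /\ commutant (commutant M) = M.

Definition vN_generated (S : set (H -> H)) : set (H -> H) :=
  smallest von_neumann S.

Definition factor (M : set (H -> H)) : Prop :=
  von_neumann M /\
  M `&` commutant M = range (fun (c : R[i]) (u : H) => c *: u).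

Definition projection (p : H -> H) : Prop := p \o p = p /\ adj p = p.

Definition minimal_projection (M : set (H -> H)) (p : H -> H) : Prop :=
  [/\ M p, projection p, p <> cst 0 &
      forall q, M q -> projection q -> p \o q = q -> q = cst 0 \/ q = p].

(* A factor is of type II_1 iff its unit is a finite projection (every isometry
   in it is unitary) and it has no minimal projection. *)
Definition II1_factor (M : set (H -> H)) : Prop :=
  [/\ factor M,
      forall v, M v -> adj v \o v = idfun -> v \o adj v = idfun &
      forall p, ~ minimal_projection M p].

Definition tracial_state (M : set (H -> H)) (tau : (H -> H) -> R[i]) : Prop :=
  [/\ forall (c : R[i]) x y, M x -> M y ->
        tau (fun u => c *: x u + y u) = c * tau x + tau y,
      forall x, M x -> 0 <= tau (adj x \o x),
      tau idfun = 1 &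
      forall x y, M x -> M y -> tau (x \o y) = tau (y \o x)].

(* H is L^2(M, tau), the completion of M for <x, y> = tau (y^* x), where x in M
   is identified with the vector x xi0; in particular M acts by left
   multiplication and xi0 is the cyclic trace unit vector. *)
Definition is_L2 (M : set (H -> H)) (tau : (H -> H) -> R[i]) (xi0 : H) : Prop :=
  (forall x y, M x -> M y -> ip (x xi0) (y xi0) = tau (adj y \o x)) /\
  closure [set x xi0 | x in M] = setT.

(* These conditions determine J, because M xi0 is dense; J is then a
   conjugate-linear isometric involution. *)
Definition modular_conjugation (M : set (H -> H)) (xi0 : H) (J : H -> H) :
    Prop :=
  continuous J /\ forall x, M x -> J (x xi0) = adj x xi0.

Definition orth_proj (K : set H) (u : H) : H :=
  get [set v | K v /\ forall w, K w -> ip (u - v) w = 0].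

Definition L2 (P : set (H -> H)) (xi0 : H) : set H :=
  closure [set x xi0 | x in P].

Definition jones_projection (P : set (H -> H)) (xi0 : H) : H -> H :=
  orth_proj (L2 P xi0).

Definition basic_extension (M P : set (H -> H)) (xi0 : H) : set (H -> H) :=
  vN_generated (M `|` [set jones_projection P xi0]).

Definition SOT_sum_to (a : nat -> H -> H) (T : H -> H) : Prop :=
  forall u : H, series (fun n => a n u) @ \oo --> T u.

(* The class of sequences denoted by a gothic S; indices start at 0. *)
Definition frakS (M : set (H -> H)) (z : nat -> H -> H) : Prop :=
  [/\ forall n, M (z n),
      SOT_sum_to (fun n => z n \o adj (z n)) idfun,
      SOT_sum_to (fun n => adj (z n) \o z n) idfun &
      forall n, exists k, adj (z n) = z k].

(* The sum over n of Ad (J z_n J), as a strong operator limit. *)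
Definition phi (J : H -> H) (z : nat -> H -> H) (T : H -> H) : H -> H :=
  fun u => limn (series (fun n => Ad (J \o z n \o J) T u)).

Definition BH_fixed (f : (H -> H) -> (H -> H)) : set (H -> H) :=
  [set T | BH T /\ f T = T].

Definition conj_by (J : H -> H) (S : set (H -> H)) : set (H -> H) :=
  [set J \o x \o J | x in S].

End Operators.

(* Main.v *)
(* The trace vector gives M' = JMJ: for T in M' one has J T xi0 = T^* xi0, and
   evaluating at the vectors S xi0 with S in M' shows that JTJ commutes with M'.
   So an element of M' is T = JxJ with x in M, and phi T = T evaluated at xi0
   says that sum_n z_n x z_n^* xi0 = x xi0.  Expanding the squares and using
   x z_n^* xi0 = J z_n J x xi0, one gets
     sum_n |(x z_n^* - z_n^* x) xi0|^2
       = |J x xi0|^2 - 2 Re <sum_n z_n x z_n^* xi0, x xi0> + |x xi0|^2 = 0,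
   and x commutes with all z_n because xi0 is separating.  Conversely, if x in M
   commutes with P, then JxJ commutes with every T = JyJ in M' that commutes
   with e_P: y xi0 is a limit of vectors p xi0 with p in P, hence
   x y xi0 = y x xi0.  Finally (M u {e_P})'' commutes with the operators
   J z_n J, because L^2(P) is invariant under JPJ, so it is fixed by phi. *)

Require Import Defs.
From HB Require Import structures.
From mathcomp Require Import all_boot all_order all_algebra.
From mathcomp Require Import complex.
From mathcomp Require Import all_classical all_reals all_analysis.
From mathcomp Require Import ring lra.
Import Order.TTheory GRing.Theory Num.Theory.
Import numFieldNormedType.Exports.

Local Open Scope classical_set_scope.
Local Open Scope complex_scope.
Local Open Scope ring_scope.

Set Implicit Arguments.
Unset Strict Implicit.
Unset Printing Implicit Defensive.

(** * Inner product *)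

Section HilbertSpace.
Context {R : realType} {H : completeNormedModType R[i]}.
Context {ip : {dot H for Num.conj}}.
Hypothesis hip : hilbert ip.
Implicit Types (u v w : H) (a b : R[i]).

Lemma ipC u v : ip u v = Num.conj (ip v u).
Proof. by rewrite hermC /= expr0 mul1r. Qed.

Lemma ipDl u v w : ip (u + v) w = ip u w + ip v w.
Proof. exact: linearDl. Qed.

Lemma ipDr u v w : ip w (u + v) = ip w u + ip w v.
Proof. exact: linearDr. Qed.

Lemma ipBl u v w : ip (u - v) w = ip u w - ip v w.
Proof. exact: linearBl. Qed.

Lemma ipBr u v w : ip w (u - v) = ip w u - ip w v.
Proof. exact: linearBr. Qed.

Lemma ipZl a u v : ip (a *: u) v = a * ip u v.
Proof. by rewrite linearZl_LR. Qed.

Lemma ipZr a u v : ip u (a *: v) = Num.conj a * ip u v.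
Proof. by rewrite linearZr_LR. Qed.

Lemma ip0l u : ip 0 u = 0. Proof. exact: linear0l. Qed.

Lemma ip0r u : ip u 0 = 0. Proof. exact: linear0r. Qed.

Lemma ip_suml n m (f : nat -> H) v :
  ip (\sum_(n <= k < m) f k) v = \sum_(n <= k < m) ip (f k) v.
Proof. exact: linear_sumlz. Qed.

Lemma ip_inj u v : (forall w, ip u w = ip v w) -> u = v.
Proof.
move=> h; apply/eqP; rewrite -subr_eq0 -(dnorm_eq0 ip).
by rewrite ipBl h subrr.
Qed.

Lemma ip_injr u v : (forall w, ip w u = ip w v) -> u = v.
Proof. by move=> h; apply: ip_inj => w; rewrite ipC h -ipC. Qed.

(* The order of R[i] is only partial and its norm is R[i]-valued, so estimates
   are carried out on the real parts. *)
Definition rn u : R := complex.Re `|u|.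
Definition rip u v : R := complex.Re (ip u v).

Lemma rnE u : `|u| = (rn u)%:C.
Proof. by rewrite /rn RRe_real// normr_real. Qed.

Lemma rn_ge0 u : 0 <= rn u.
Proof. by have := normr_ge0 u; rewrite rnE ler0c. Qed.

Lemma ipE u : ip u u = (rn u ^+ 2)%:C.
Proof. by rewrite -hip rnE -rmorphXn. Qed.

Lemma ripE u : rip u u = rn u ^+ 2.
Proof. by rewrite /rip ipE. Qed.

Lemma ripC u v : rip u v = rip v u.
Proof. by rewrite /rip ipC; case: (ip v u). Qed.

Lemma ripDl u v w : rip (u + v) w = rip u w + rip v w.
Proof. by rewrite /rip ipDl raddfD. Qed.

Lemma ripBl u v w : rip (u - v) w = rip u w - rip v w.
Proof. by rewrite /rip ipBl raddfB. Qed.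

Lemma ripNl u v : rip (- u) v = - rip u v.
Proof. by rewrite -[- u]sub0r ripBl /rip ip0l sub0r. Qed.

Lemma ripDr u v w : rip w (u + v) = rip w u + rip w v.
Proof. by rewrite /rip ipDr raddfD. Qed.

Lemma ripBr u v w : rip w (u - v) = rip w u - rip w v.
Proof. by rewrite /rip ipBr raddfB. Qed.

Lemma ripZl (r : R) u v : rip (r%:C *: u) v = r * rip u v.
Proof. by rewrite /rip ipZl; case: (ip u v) => x y /=; rewrite mul0r subr0. Qed.

Lemma ripZr (r : R) u v : rip u (r%:C *: v) = r * rip u v.
Proof. by rewrite ripC ripZl ripC. Qed.

Lemma rip_suml n m (f : nat -> H) v :
  rip (\sum_(n <= k < m) f k) v = \sum_(n <= k < m) rip (f k) v.
Proof. by rewrite /rip ip_suml raddf_sum. Qed.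

Lemma rnD2 u v : rn (u + v) ^+ 2 = rn u ^+ 2 + 2 * rip u v + rn v ^+ 2.
Proof. by rewrite -!ripE ripDl !ripDr (ripC v u); ring. Qed.

Lemma rnB2 u v : rn (u - v) ^+ 2 = rn u ^+ 2 - 2 * rip u v + rn v ^+ 2.
Proof. by rewrite -!ripE ripBl !ripBr (ripC v u); ring. Qed.

Lemma rn0 : rn 0 = 0. Proof. by rewrite /rn normr0. Qed.

Lemma rn_eq0 u : rn u = 0 -> u = 0.
Proof. by move=> u0; apply: normr0_eq0; rewrite rnE u0. Qed.

Lemma rnN u : rn (- u) = rn u. Proof. by rewrite /rn normrN. Qed.

Lemma rnBC u v : rn (u - v) = rn (v - u). Proof. by rewrite -opprB rnN. Qed.

Lemma rnD u v : rn (u + v) <= rn u + rn v.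
Proof. by have := ler_normD u v; rewrite !rnE -rmorphD lecR. Qed.

Lemma rn_trans u v w : rn (u - w) <= rn (u - v) + rn (v - w).
Proof. by rewrite -[u - w](subrKA v) rnD. Qed.

Lemma rnZr (r : R) u : rn (r%:C *: u) = `|r| * rn u.
Proof.
by rewrite /rn normrZ rnE normc_def /= expr0n addr0 sqrtr_sqr mulr0 subr0.
Qed.

(** The form is conjugate-linear in its second argument, so the real part of <u, iv> is the
    imaginary part of <u, v>. *)
Lemma ip_eq0_rip u v : rip u v = 0 -> rip u ('i *: v) = 0 -> ip u v = 0.
Proof.
rewrite /rip ipZr; case: (ip u v) => x y /= ->.
by rewrite mul0r sub0r mulN1r opprK => ->.
Qed.

(** With a = |u| and b = |v|, expanding |bu - av|^2 >= 0 gives 2ab(ab - Re <u, v>) >= 0. The lower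
    bound on Re <u, v> is obtained where needed by replacing u with -u. *)
Lemma rip_CS u v : rip u v <= rn u * rn v.
Proof.
have [v0|v0] := eqVneq (rn v) 0.
  by rewrite (rn_eq0 v0) rn0 mulr0 /rip ip0r.
have rv : 0 < rn v by rewrite lt_neqAle eq_sym v0 rn_ge0.
have [u0|u0] := eqVneq (rn u) 0.
  by rewrite (rn_eq0 u0) rn0 mul0r /rip ip0l.
have ru : 0 < rn u by rewrite lt_neqAle eq_sym u0 rn_ge0.
have := sqr_ge0 (rn ((rn v)%:C *: u - (rn u)%:C *: v)).
rewrite rnB2 ripZl ripZr !rnZr !(ger0_norm (rn_ge0 _)) => h.
have {}h : 0 <= 2 * (rn u * rn v) * (rn u * rn v - rip u v) by nra.
have rr : 0 < 2 * (rn u * rn v) by rewrite !mulr_gt0.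
by rewrite -subr_ge0 -(pmulr_rge0 _ rr).
Qed.

Lemma parallelogram u v :
  rn (u + v) ^+ 2 + rn (u - v) ^+ 2 = 2 * rn u ^+ 2 + 2 * rn v ^+ 2.
Proof. by rewrite rnD2 rnB2; ring. Qed.

(** A positive element of R[i] is real, so radii in R suffice. *)
Lemma cvg_rnP {T : Type} {F : set_system T} {FF : Filter F} (f : T -> H) l :
  f @ F --> l <-> forall e : R, 0 < e -> \forall t \near F, rn (l - f t) < e.
Proof.
split=> [/cvgrPdist_lt h e e0|h].
  have := h e%:C; rewrite ltcR => /(_ e0); apply: filterS => t.
  by rewrite rnE ltcR.
apply/cvgrPdist_lt => e e0.
have er : e = (complex.Re e)%:C by rewrite RRe_real// gtr0_real.
move: e0; rewrite er ltcR => /h; apply: filterS => t.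
by rewrite rnE ltcR.
Qed.

Lemma closure_rnP (A : set H) u :
  closure A u <-> forall e : R, 0 < e -> exists2 a, A a & rn (u - a) < e.
Proof.
split=> [h e e0|h B].
  have := h (ball u e%:C) (nbhsx_ballx _ _ _).
  rewrite ltcR => /(_ e0) [a [Aa]].
  by rewrite -ball_normE /= rnE ltcR => ua; exists a.
move=> /nbhs_ballP[e /= e0 eB].
have er : e = (complex.Re e)%:C by rewrite RRe_real// gtr0_real.
move: e0; rewrite er ltcR => /h[a Aa ua]; exists a; split => //.
by apply: eB; rewrite -ball_normE /= rnE er ltcR.
Qed.

Lemma cauchy_rn (f : nat -> H) :
  (forall e : R, 0 < e -> exists N, forall m n, (N <= n <= m)%N ->
     rn (f m - f n) < e) -> cvgn f.
Proof.
move=> h; apply: cauchy_cvg; apply: cauchy_exP => e /= e0.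
have er : e = (complex.Re e)%:C by rewrite RRe_real// gtr0_real.
move: (e0); rewrite er ltcR => /h[N hN]; exists (f N).
exists N => // m /= Nm; rewrite -ball_normE /= rnE ltcR rnBC.
by apply: hN; rewrite leqnn Nm.
Qed.

End HilbertSpace.

Arguments rip {R H} ip u v.

(** * Projections, Riesz representation and adjoints *)

Section Operators.
Context {R : realType} {H : completeNormedModType R[i]}.
Context {ip : {dot H for Num.conj}}.
Hypothesis hip : hilbert ip.
Implicit Types (u v w : H) (S T : H -> H).

Lemma rn_dist u v : `|rn u - rn v| <= rn (u - v).
Proof.
have h1 := rn_trans u v 0; have h2 := rn_trans v u 0.
by rewrite !subr0 (rnBC v) in h1 h2; rewrite ler_norml; lra.
Qed.

Lemma cvg_rn {A : Type} {F : set_system A} {FF : Filter F} (f : A -> H) (l : H) :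
  f @ F --> l -> rn (f t) @[t --> F] --> rn l.
Proof.
move=> /cvg_rnP h; apply/cvgrPdist_lt => e /h; apply: filterS => t.
exact: le_lt_trans (rn_dist _ _).
Qed.

Lemma cvg_rip {A : Type} {F : set_system A} {FF : Filter F} (f : A -> H)
    (l v : H) :
  f @ F --> l -> rip ip (f t) v @[t --> F] --> rip ip l v.
Proof.
move=> /cvg_rnP h; apply/cvgrPdist_lt => e e0.
(* The added 1 keeps the denominator positive when v = 0. *)
have e1 : 0 < e / (rn v + 1) by rewrite divr_gt0// ltr_wpDl// rn_ge0.
have v1 : 0 < rn v + 1 by rewrite ltr_wpDl// rn_ge0.
apply: filterS (h _ e1) => t lt; rewrite -ripBl.
have h1 := rip_CS hip (l - f t) v; have h2 := rip_CS hip (f t - l) v.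
have h3 : rn (l - f t) * rn v < e.
  rewrite ltr_pdivlMr// in lt; have := rn_ge0 (l - f t); nra.
rewrite rnBC -(opprB l) ripNl in h2.
rewrite ltr_norml; lra.
Qed.

(** A sequence in K minimizing the distance to u is Cauchy by the parallelogram law; its limit
    attains the minimum, and minimality forces orthogonality. *)
Lemma projection_theorem (K : set H) u :
  K 0 -> (forall (a : R[i]) v w, K v -> K w -> K (a *: v + w)) ->
  closure K `<=` K ->
  exists2 v, K v & forall w, K w -> ip (u - v) w = 0.
Proof.
move=> K0 Klin Kcl.
pose E : set R := [set rn (u - w) ^+ 2 | w in K]; pose d := inf E.
have hE : has_inf E.
  split; first by exists (rn (u - 0) ^+ 2); exists 0.
  by exists 0 => _ [w _ <-]; apply: sqr_ge0.
have dle w : K w -> d <= rn (u - w) ^+ 2.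
  by move=> Kw; apply: ge_inf; [case: hE|exists w].
have /choice[f hf] (n : nat) : exists w, K w /\ rn (u - w) ^+ 2 < d + n.+1%:R^-1.
  have [|_ [w Kw <-] hw] := @inf_adherent _ E n.+1%:R^-1 _ hE => //.
  by exists w.
have fcauchy : cvgn f.
  apply: cauchy_rn => e e0.
  have e2 : 0 < e ^+ 2 / 4 by rewrite divr_gt0// exprn_gt0.
  (* From this N on, the excess 1/(k+1) over the infimum d is below e^2/4. *)
  pose N := Num.truncn (e ^+ 2 / 4)^-1; exists N => m n /andP[Nn nm].
  have Nlt k : (N <= k)%N -> k.+1%:R^-1 < e ^+ 2 / 4.
    move=> Nk; rewrite -[ltRHS]invrK ltf_pV2 ?posrE ?invr_gt0//.
    apply: lt_le_trans (truncnS_gt _) _.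
    by rewrite ler_nat ltnS.
  have hm := Nlt _ (leq_trans Nn nm); have hn := Nlt _ Nn.
  have [Km hKm] := hf m; have [Kn hKn] := hf n.
  (* The midpoint of f m and f n lies in K, so its squared distance to u is at least d; the
     parallelogram law then leaves less than e^2 for |f m - f n|^2. *)
  have Kmid : K ((2^-1)%:C *: (f m) + ((2^-1)%:C *: (f n) + 0)).
    by apply: (Klin) => //; apply: Klin.
  have := dle _ Kmid; rewrite addr0 => hd.
  have := parallelogram hip (u - f n) (u - f m).
  have -> : (u - f n) - (u - f m) = f m - f n by rewrite opprB addrC subrKA.
  have -> : u - f n + (u - f m) =
     2%:C *: (u - ((2^-1)%:C *: f m + (2^-1)%:C *: f n)).
    rewrite scalerBr scalerDr !scalerA -!rmorphM /= divff ?scale1r//.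
    rewrite -[2]/(1 + 1) rmorphD scalerDl !scale1r opprD; rewrite addrACA.
    by rewrite [- f n - f m]addrC.
  rewrite rnZr exprMn normr_nat => hp.
  rewrite -(@ltr_pXn2r _ 2) ?nnegrE ?rn_ge0 ?ltW//.
  set y := rn (f m - f n).
  pose x := rn (u - ((2^-1)%:C *: f m + (2^-1)%:C *: f n)).
  pose a := rn (u - f m); pose b := rn (u - f n).
  have {}hp : 2 ^+ 2 * x ^+ 2 + y ^+ 2 = 2 * b ^+ 2 + 2 * a ^+ 2 := hp.
  have {}hd : d <= x ^+ 2 := hd.
  have {}hKm : a ^+ 2 < d + e ^+ 2 / 4 by apply: lt_trans hKm _; rewrite ltrD2l.
  have {}hKn : b ^+ 2 < d + e ^+ 2 / 4 by apply: lt_trans hKn _; rewrite ltrD2l.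
  by clearbody a b x y d; lra.
have /cvg_ex[v fv] := fcauchy.
have Kv : K v.
  apply: Kcl; apply/closure_rnP => e e0.
  have /cvg_rnP/(_ e e0)[N _ /(_ N (leqnn N)) hN] := fv.
  by exists (f N) => //; have [] := hf N.
exists v => // w Kw.
have uv : rn (u - v) ^+ 2 <= d.
  have uf : (u - f n) @[n --> \oo] --> u - v by apply: cvgB => //; exact: cvg_cst.
  have h1 : rn (u - f n) ^+ 2 @[n --> \oo] --> rn (u - v) ^+ 2.
    by rewrite !expr2; under eq_fun do rewrite expr2; apply: cvgM; exact: cvg_rn.
  have h2 : (d + n.+1%:R^-1 : R) @[n --> \oo] --> d.
    rewrite -[X in _ --> X]addr0.
    by apply: cvgD; [exact: cvg_cst|exact: cvg_harmonic].
  apply: (ler_cvg_to h1 h2); apply: nearW => n.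
  by apply: ltW; have [] := hf n.
have orth w' : K w' -> rip ip (u - v) w' = 0.
  move=> Kw'; set r := rip _ _ _.
  have [q0|q0] := eqVneq (rn w') 0.
    by rewrite /r (rn_eq0 q0) /rip ip0r.
  have qp : 0 < rn w' ^+ 2 by rewrite exprn_gt0// lt_neqAle eq_sym q0 rn_ge0.
  (* This t minimizes |u - v - t w'|^2 over real t; the minimum is |u - v|^2 - r^2/|w'|^2, so r must
     vanish. *)
  pose t := r / rn w' ^+ 2.
  have Kt : K (t%:C *: w' + v) by apply: Klin.
  have := le_trans uv (dle _ Kt).
  have -> : u - (t%:C *: w' + v) = (u - v) - t%:C *: w'.
    by rewrite opprD addrCA addrC.
  rewrite (rnB2 hip (u - v) (_ *: _)) ripZr rnZr exprMn real_normK ?num_real//.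
  rewrite -/r /t => h.
  have {}h : r ^+ 2 / rn w' ^+ 2 <= 0.
    have e1 : (r / rn w' ^+ 2) ^+ 2 * rn w' ^+ 2 = r ^+ 2 / rn w' ^+ 2.
      by field; rewrite q0.
    rewrite e1 in h.
    have e2 : r / rn w' ^+ 2 * r = r ^+ 2 / rn w' ^+ 2 by field; rewrite q0.
    by rewrite e2 in h; lra.
  rewrite pmulr_lle0 ?invr_gt0// in h.
  by apply/eqP; rewrite -sqrf_eq0 eq_le h sqr_ge0.
apply: ip_eq0_rip; first exact: orth.
by apply: orth; rewrite -[_ *: _]addr0; apply: Klin.
Qed.

Lemma ip_closed x v :
  (forall e : R, 0 < e -> exists2 a, ip a v = 0 & rn (x - a) < e) -> ip x v = 0.
Proof.
move=> h.
(* Used with w = v and w = iv, which give the real and imaginary parts of <x, v>. *)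
have hz w : (forall a, ip a v = 0 -> rip ip a w = 0) -> rip ip x w = 0.
  move=> aw; apply/eqP; rewrite eq_le !leNgt; apply/andP; split; apply/negP => xw.
    have w1 : 0 < rn w + 1 by rewrite ltr_wpDl// rn_ge0.
    have [a av] := h (rip ip x w / (rn w + 1)) (divr_gt0 xw w1).
    have := rip_CS hip (x - a) w; rewrite ripBl (aw a av) subr0 ltr_pdivlMr//.
    by have := rn_ge0 (x - a); nra.
  have w1 : 0 < rn w + 1 by rewrite ltr_wpDl// rn_ge0.
  have xw' : 0 < - rip ip x w by rewrite oppr_gt0.
  have [a av] := h (- rip ip x w / (rn w + 1)) (divr_gt0 xw' w1).
  have := rip_CS hip (a - x) w; rewrite ripBl (aw a av) sub0r ltr_pdivlMr//.
  by rewrite rnBC; have := rn_ge0 (x - a); nra.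
apply: ip_eq0_rip; apply: hz => a av; first by rewrite /rip av.
by rewrite /rip ipZr av mulr0.
Qed.

Lemma BH0 T : BH T -> T 0 = 0.
Proof. by move=> [lT _]; have := lT (-1) 0 0; rewrite !scaleN1r !addNr. Qed.

Lemma BHlin T : BH T -> forall a u v, T (a *: u + v) = a *: T u + T v.
Proof. by case. Qed.

Lemma BHZ T a u : BH T -> T (a *: u) = a *: T u.
Proof. by move=> BT; rewrite -[a *: u]addr0 BHlin// BH0// !addr0. Qed.

Lemma BHD T u v : BH T -> T (u + v) = T u + T v.
Proof. by move=> BT; rewrite -[u]scale1r BHlin// !scale1r. Qed.

Lemma BHB T u v : BH T -> T (u - v) = T u - T v.
Proof. by move=> BT; rewrite -[- v]scaleN1r BHD// BHZ// scaleN1r. Qed.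

Lemma BH_sum T n m (f : nat -> H) : BH T ->
  T (\sum_(n <= k < m) f k) = \sum_(n <= k < m) T (f k).
Proof.
by move=> BT; elim/big_rec2: _ => [|k x y _ <-]; [exact: BH0|rewrite BHD].
Qed.

(** By continuity at 0 some ball of radius r is mapped into the unit ball; rescaling u to norm r/2
    yields C = 2/r. *)
Lemma BH_bounded T : BH T ->
  exists2 C : R, 0 < C & forall u, rn (T u) <= C * rn u.
Proof.
move=> BT; have /cvg_rnP := BT.2 0.
move=> /(_ 1 ltr01) /nbhs_ballP[d d0 hd].
have dr : d = (complex.Re d)%:C by rewrite RRe_real// gtr0_real.
set r := complex.Re d in dr; have r0 : 0 < r by rewrite -ltcR -dr.
exists (2 / r); first by rewrite divr_gt0.
move=> u; have [u0|u0] := eqVneq (rn u) 0.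
  by rewrite (rn_eq0 u0) BH0// rn0 mulr0.
have up : 0 < rn u by rewrite lt_neqAle eq_sym u0 rn_ge0.
have c0 : 0 < r / 2 / rn u by rewrite !divr_gt0.
have := hd ((r / 2 / rn u)%:C *: u); rewrite -ball_normE /= sub0r normrN rnE.
rewrite dr ltcR rnZr (gtr0_norm c0) divfK// BH0// sub0r => /(_ _)/wrap[].
  by rewrite ltr_pdivrMr// ltr_pMr// ltr1n.
rewrite rnN BHZ// rnZr (gtr0_norm c0) => h.
rewrite -(ler_pM2l c0) (le_trans (ltW h))//.
have -> : r / 2 / rn u * (2 / r * rn u) = 1 by field; rewrite u0 gt_eqF.
by [].
Qed.

Lemma bounded_BH T (C : R) : linear T -> (forall u, rn (T u) <= C * rn u) -> BH T.
Proof.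
move=> lT hC; split => // u; apply/cvg_rnP => e e0.
have C1 : 0 < `|C| + 1 by rewrite ltr_wpDl.
have TB x y : T x - T y = T (x - y).
  by rewrite [x - y]addrC -[- y]scaleN1r lT scaleN1r addrC.
have /cvg_rnP/(_ _ (divr_gt0 e0 C1)) := @cvg_id _ (nbhs u).
apply: filterS => t; rewrite ltr_pdivlMr// TB => h; apply: le_lt_trans h.
apply: (le_trans (hC _)); rewrite mulrC ler_wpM2l ?rn_ge0//.
by rewrite (le_trans (ler_norm _))// lerDl.
Qed.

Lemma BH_id : BH (@idfun H).
Proof. by split => // u; exact: cvg_id. Qed.

Lemma BH_comp S T : BH S -> BH T -> BH (S \o T).
Proof.
move=> [lS cS] [lT cT]; split => [a u v /=|u]; first by rewrite lT lS.
by apply: continuous_comp; [exact: cT|exact: cS].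
Qed.

(** If f is not zero, the component w of some vector u0 orthogonal to the closed kernel of f is not
    zero, and a multiple of w represents f. *)
Lemma riesz (f : H -> R[i]) :
  (forall a u v, f (a *: u + v) = a * f u + f v) ->
  closure [set u | f u = 0] `<=` [set u | f u = 0] ->
  exists v, forall u, f u = ip u v.
Proof.
move=> flin fcl.
have [f0|/existsNP[u0 fu0]] := pselect (forall u, f u = 0).
  by exists 0 => u; rewrite f0 ip0r.
have [||v fv0 orth] := @projection_theorem [set u | f u = 0] u0 _ _ fcl.
- by have := flin (-1) 0 0; rewrite scaleN1r mulN1r !addNr.
- by move=> a v w /= fv fw; rewrite flin fv fw mulr0 addr0.
set w := u0 - v in orth.
have fw : f w = f u0 by rewrite /w [_ - v]addrC -scaleN1r flin fv0 mulr0 add0r.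
have w0 : ip w w != 0.
  apply/eqP => /eqP; rewrite dnorm_eq0 => /eqP w0; apply: fu0.
  by rewrite -fw w0; have := flin (-1) 0 0; rewrite scaleN1r mulN1r !addNr.
exists (Num.conj (f w / ip w w) *: w) => u; rewrite ipZr conjCK.
have fw0 : f w != 0 by rewrite fw; apply/eqP.
(* Subtracting (f u / f w) w moves u into the kernel, hence into the orthogonal complement of w. *)
have /orth : f (- (f u / f w) *: w + u) = 0 by rewrite flin mulNr divfK// addNr.
rewrite ipDr ipZr rmorphN mulNr => /eqP; rewrite addrC subr_eq0 => /eqP h.
by rewrite (ipC u) h rmorphM /= conjCK -(ipC w w); field; apply/andP.
Qed.

Lemma adj_exists T : BH T ->
  exists S, BH S /\ forall u v, ip (T u) v = ip u (S v).
Proof.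
move=> BT; have [C C0 hC] := BH_bounded BT.
have /choice[S hS] v : exists w, forall u, ip (T u) v = ip u w.
  apply: (riesz (f := fun u => ip (T u) v)) => [a x y|u /closure_rnP h /=].
    by rewrite BHlin// ipDl ipZl.
  apply: ip_closed => e e0; have [a av ua] := h (e / C) (divr_gt0 e0 C0).
  exists (T a) => //; rewrite -BHB//; apply: le_lt_trans (hC _) _.
  by rewrite mulrC -ltr_pdivlMr.
exists S; split => [|u v]; last exact: hS.
apply: (@bounded_BH _ C) => [a u v|v].
  apply: (ip_injr (ip := ip)) => w.
  by rewrite -hS ipDr [ip (T w) _]ipZr !hS -ipZr -ipDr.
(* |Sv|^2 = Re <TSv, v> <= C |Sv| |v|, so S inherits the bound C of T. *)
have := rip_CS hip (T (S v)) v; rewrite /rip hS -/(rip ip _ _) (ripE hip) => h.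
have {}h := le_trans h (ler_wpM2r (rn_ge0 v) (hC (S v))).
have [->|s0] := eqVneq (rn (S v)) 0; first by rewrite mulr_ge0 ?rn_ge0// ltW.
have sp : 0 < rn (S v) by rewrite lt_neqAle eq_sym s0 rn_ge0.
by rewrite -(ler_pM2l sp) -expr2 mulrA [rn (S v) * C]mulrC.
Qed.

(** [adj] is a choice operator, so its specification is available only once existence is known. *)
Lemma adjP T : BH T ->
  BH (adj ip T) /\ forall u v, ip (T u) v = ip u (adj ip T v).
Proof.
by case/adj_exists => S; exact: (@getI _ [set S | BH S /\
  forall u v, ip (T u) v = ip u (S v)]).
Qed.

Lemma BH_adj T : BH T -> BH (adj ip T).
Proof. by case/adjP. Qed.

Lemma ip_adj T u v : BH T -> ip (T u) v = ip u (adj ip T v).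
Proof. by case/adjP. Qed.

Lemma ip_adjl T u v : BH T -> ip (adj ip T u) v = ip u (T v).
Proof. by move=> BT; rewrite ipC -ip_adj// -ipC. Qed.

Lemma adj_unique S T :
  BH T -> (forall u v, ip (T u) v = ip u (S v)) -> adj ip T = S.
Proof.
move=> BT h; apply/funext => v; apply: (ip_injr (ip := ip)) => u.
by rewrite -ip_adj.
Qed.

Lemma adjK T : BH T -> adj ip (adj ip T) = T.
Proof.
by move=> BT; apply: adj_unique => [|u v]; [exact: BH_adj|exact: ip_adjl].
Qed.

Lemma adj_comp S T : BH S -> BH T -> adj ip (S \o T) = adj ip T \o adj ip S.
Proof.
move=> BS BT; apply: adj_unique => [|u v /=]; first exact: BH_comp.
by rewrite !ip_adj.
Qed.

End Operators.

(** * Commutants *)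

Section Commutants.
Context {R : realType} {H : completeNormedModType R[i]}.
Context {ip : {dot H for Num.conj}}.
Hypothesis hip : hilbert ip.
Implicit Types (S T : H -> H) (A B : set (H -> H)).

Definition self_adjoint_set A := forall s, A s -> BH s /\ A (adj ip s).

Lemma sub_commutant A B : A `<=` B -> commutant B `<=` commutant A.
Proof. by move=> AB T [BT hT]; split => // s /AB; exact: hT. Qed.

Lemma sub_bicommutant A : A `<=` @BH _ H -> A `<=` commutant (commutant A).
Proof. by move=> AB T AT; split=> [|s [_ hs]]; [exact: AB|rewrite hs]. Qed.

Lemma commutant_BH A : commutant A `<=` @BH _ H.
Proof. by move=> T []. Qed.

Lemma tricommutant A : A `<=` @BH _ H ->
  commutant (commutant (commutant A)) = commutant A.
Proof.
move=> AB; apply/seteqP; split; first exact/sub_commutant/sub_bicommutant.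
exact/sub_bicommutant/commutant_BH.
Qed.

(** Take adjoints in T s^* = s^* T, where s^* is again in A. *)
Lemma self_adjoint_commutant A :
  self_adjoint_set A -> self_adjoint_set (commutant A).
Proof.
move=> hA T [BT hT]; split => //; split; first exact: BH_adj.
move=> s /hA[Bs As]; rewrite -{1}(adjK hip Bs) -adj_comp//; last exact: BH_adj.
by rewrite -hT// adj_comp//; [rewrite adjK|exact: BH_adj].
Qed.

Lemma commutant_von_neumann A :
  self_adjoint_set A -> von_neumann ip (commutant A).
Proof.
move=> hA; split=> [T /(self_adjoint_commutant hA)[]//|].
by apply: tricommutant => s /hA[].
Qed.

(** The bicommutant is a von Neumann algebra containing A, and any von Neumann algebra N containing
    A contains A'', because N'' = N. *)
Lemma vN_generatedE A :
  self_adjoint_set A -> vN_generated ip A = commutant (commutant A).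
Proof.
move=> hA; have AB : A `<=` @BH _ H by move=> s /hA[].
apply/seteqP; split.
  apply: smallest_sub; last exact: sub_bicommutant.
  exact/commutant_von_neumann/self_adjoint_commutant.
move=> T hT N [[_ NE] AN]; rewrite -NE.
by apply: sub_commutant hT; apply: sub_commutant.
Qed.

Lemma von_neumann_BH A : von_neumann ip A -> A `<=` @BH _ H.
Proof. by move=> [_ <-]; exact: commutant_BH. Qed.

Lemma von_neumann_self_adjoint A : von_neumann ip A -> self_adjoint_set A.
Proof.
by move=> vA s As; split; [exact: von_neumann_BH As|case: vA => + _; apply].
Qed.

Lemma commutant_id A : A `<=` @BH _ H -> commutant A (@idfun H).
Proof. by move=> AB; split => //; exact: BH_id. Qed.

Lemma commutant_comp A S T :
  commutant A S -> commutant A T -> commutant A (S \o T).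
Proof.
move=> [BS hS] [BT hT]; split; first exact: BH_comp.
by move=> s As; rewrite -compA hT// compA hS// compA.
Qed.

(** Gives closure under linear combinations for [M] and [P], each being a commutant by the
    bicommutant condition. *)
Lemma commutant_lin A (a : R[i]) S T : A `<=` @BH _ H ->
  commutant A S -> commutant A T -> commutant A (fun u => a *: S u + T u).
Proof.
move=> AB [BS hS] [BT hT]; split; first split.
- move=> c u v; rewrite (BHlin BS) (BHlin BT) scalerDr (scalerDr c) !scalerA.
  by rewrite [a * c]mulrC addrACA.
- move=> u; apply: cvgD; last exact: BT.2.
  by apply: cvgZ; [exact: cvg_cst|exact: BS.2].
move=> s As; apply/funext => u /=; rewrite BHlin; last exact: AB.
by move: (congr1 (@^~ u) (hS s As)) (congr1 (@^~ u) (hT s As)) => /= -> ->.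
Qed.

End Commutants.

(** * Orthogonal projection onto a closed subspace *)

Section OrthogonalProjection.
Context {R : realType} {H : completeNormedModType R[i]}.
Context {ip : {dot H for Num.conj}}.
Hypothesis hip : hilbert ip.
Variable K : set H.
Hypotheses (K0 : K 0) (Kcl : closure K `<=` K).
Hypothesis (Klin : forall (a : R[i]) v w, K v -> K w -> K (a *: v + w)).
Local Notation e := (orth_proj ip K).
Implicit Types u v w : H.

Lemma orth_projP u : K (e u) /\ forall w, K w -> ip (u - e u) w = 0.
Proof.
have [v Kv hv] := projection_theorem hip u K0 Klin Kcl.
exact: (@getI _ [set v | K v /\ forall w, K w -> ip (u - v) w = 0] v).
Qed.

Lemma orth_proj_unique u v :
  K v -> (forall w, K w -> ip (u - v) w = 0) -> e u = v.
Proof.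
move=> Kv hv; have [Ke he] := orth_projP u.
apply/eqP; rewrite -subr_eq0 -(dnorm_eq0 ip).
have Kd : K (e u - v) by rewrite addrC -scaleN1r; exact: Klin.
have -> : ip (e u - v) (e u - v) = ip (u - v) (e u - v) - ip (u - e u) (e u - v).
  by rewrite -ipBl; congr (ip _ _); rewrite opprB [RHS]addrC subrKA.
by rewrite hv// he// subrr.
Qed.

Lemma orth_proj_id u : K u -> e u = u.
Proof. by move=> Ku; apply: orth_proj_unique => // w _; rewrite subrr ip0l. Qed.

Lemma orth_proj_sym u v : ip (e u) v = ip u (e v).
Proof.
have [Ku hu] := orth_projP u; have [Kv hv] := orth_projP v.
have : ip (u - e u) (e v) = 0 by exact: hu.
have : ip (e u) (v - e v) = 0 by rewrite ipC hv// rmorph0.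
rewrite ipBr ipBl => /eqP; rewrite subr_eq0 => /eqP -> /eqP.
by rewrite subr_eq0 => /eqP ->.
Qed.

Lemma orth_proj_BH : BH e.
Proof.
apply: (@bounded_BH _ _ _ 1) => [a u v|u].
  have [Ku hu] := orth_projP u; have [Kv hv] := orth_projP v.
  apply: orth_proj_unique; first exact: Klin.
  move=> w Kw.
  rewrite opprD addrACA -scalerBr ipDl ipZl hu// hv// mulr0 addr0//.
have [Ku hu] := orth_projP u; rewrite mul1r.
have := rip_CS hip u (e u); have := hu _ Ku; rewrite ipBl => /eqP.
rewrite subr_eq0 => /eqP h; rewrite /rip h -/(rip _ _ _) (ripE hip) expr2.
have [->|e0] := eqVneq (rn (e u)) 0; first by rewrite rn_ge0.
by rewrite ler_pM2r// lt_neqAle eq_sym e0 rn_ge0.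
Qed.

Lemma adj_orth_proj : adj ip e = e.
Proof.
by apply: (adj_unique hip); [exact: orth_proj_BH|exact: orth_proj_sym].
Qed.

(** T' plays the part of an adjoint of T: invariance of K under T' makes T preserve the orthogonal
    complement. T need only respect differences, so the conjugate-linear [J] is covered too. *)
Lemma orth_proj_commute (T T' : H -> H) :
  (forall u v, T (u - v) = T u - T v) ->
  (forall u w, ip u (T' w) = 0 -> ip (T u) w = 0) ->
  (forall w, K w -> K (T w)) -> (forall w, K w -> K (T' w)) ->
  T \o e = e \o T.
Proof.
move=> TB hT KT KT'; apply/funext => u /=.
have [Ku hu] := orth_projP u; apply/esym/orth_proj_unique; first exact: KT.
by move=> w Kw; rewrite -TB; apply: hT; apply: hu; exact: KT'.
Qed.

End OrthogonalProjection.

(** * Passing identities and invariance to closures *)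

Section Closure.
Context {R : realType} {H : completeNormedModType R[i]}.
Implicit Types (A B : set H) (f g : H -> H).

Lemma closure_eq_fun A f g : continuous f -> continuous g ->
  (forall u, A u -> f u = g u) -> forall u, closure A u -> f u = g u.
Proof.
move=> cf cg fg u clu; apply/eqP; rewrite -subr_eq0; apply/eqP/rn_eq0/eqP.
rewrite eq_le rn_ge0 andbT leNgt; apply/negP => d0.
have d2 : 0 < rn (f u - g u) / 2 by rewrite divr_gt0.
have := cf u; move/cvg_rnP/(_ _ d2) => hf.
have := cg u; move/cvg_rnP/(_ _ d2) => hg.
have [a [Aa /= [h1 h2]]] := clu _ (filterI hf hg).
have := rn_trans (f u) (f a) (g u); rewrite (fg a Aa) in h1 *.
by rewrite (rnBC (g a)); lra.
Qed.

Lemma image_closure A B f : continuous f ->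
  (forall u, A u -> closure B (f u)) -> forall u, closure A u -> closure B (f u).
Proof.
move=> cf fAB u clu; apply/closure_rnP => e e0.
have e2 : 0 < e / 2 by rewrite divr_gt0.
have := cf u; move/cvg_rnP/(_ _ e2) => hf.
have [a [Aa /= h1]] := clu _ hf.
have /closure_rnP/(_ _ e2)[b Bb h2] := fAB a Aa.
by exists b => //; have := rn_trans (f u) (f a) b; lra.
Qed.

End Closure.

(** * Row contractions *)

Section RowContraction.
Context {R : realType} {H : completeNormedModType R[i]}.
Context {ip : {dot H for Num.conj}}.
Hypothesis hip : hilbert ip.
Variable z : nat -> H -> H.
Hypothesis zBH : forall n, BH (z n).
Hypothesis z_sum : SOT_sum_to (fun n => z n \o adj ip (z n)) idfun.

(** Pair the strong sum of z_k z_k^* u = u with u. *)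
Lemma sum_adj_rn2 u :
  \sum_(0 <= k < n) rn (adj ip (z k) u) ^+ 2 @[n --> \oo] --> rn u ^+ 2.
Proof.
have h := cvg_rip hip (v := u) (@z_sum u); rewrite (ripE hip) in h.
have -> : (fun n => \sum_(0 <= k < n) rn (adj ip (z k) u) ^+ 2) =
    (fun n => rip ip (series (fun k => (z k \o adj ip (z k)) u) n) u).
  apply/funext => n; rewrite /series /= rip_suml; apply: eq_bigr => k _.
  by rewrite /rip (ip_adj hip)// (ipE hip).
exact: h.
Qed.

Lemma sum_adj_rn2_le n u :
  \sum_(0 <= k < n) rn (adj ip (z k) u) ^+ 2 <= rn u ^+ 2.
Proof.
have h := @sum_adj_rn2 u; rewrite -(cvg_lim (@Rhausdorff R) h).
apply: nondecreasing_cvgn_le; last by apply/cvg_ex; eexists; exact: h.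
apply/nondecreasing_seqP => m; rewrite big_nat_recr//= lerDl sqr_ge0//.
Qed.

Lemma row_contraction n m (w : nat -> H) :
  rn (\sum_(n <= k < m) z k (w k)) ^+ 2 <= \sum_(n <= k < m) rn (w k) ^+ 2.
Proof.
set s := \sum_(n <= k < m) _.
(* Expand 0 <= sum |w_k - z_k^* s|^2, where sum <w_k, z_k^* s> = |s|^2 and
   sum |z_k^* s|^2 <= |s|^2. *)
have h0 : 0 <= \sum_(n <= k < m) rn (w k - adj ip (z k) s) ^+ 2.
  by apply: sumr_ge0 => k _; exact: sqr_ge0.
have h1 : \sum_(n <= k < m) rip ip (w k) (adj ip (z k) s) = rn s ^+ 2.
  rewrite -(ripE hip) {2}/s rip_suml; apply: eq_bigr => k _.
  by rewrite /rip (ip_adj hip).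
have h2 : \sum_(n <= k < m) rn (adj ip (z k) s) ^+ 2 <= rn s ^+ 2.
  have [nm|mn] := leqP n m; last by rewrite big_geq ?sqr_ge0// ltnW.
  apply: le_trans (sum_adj_rn2_le m s).
  rewrite [leRHS](big_cat_nat _ _ (n := n))//=.
  by rewrite lerDr sumr_ge0// => k _; exact: sqr_ge0.
move: h0; under eq_bigr do rewrite (rnB2 hip).
by rewrite !big_split /= sumrN -mulr_sumr h1; lra.
Qed.

(** By [row_contraction], the squared norm of a block of terms is at most C^2 times the matching
    block of the convergent series of |z_k^* u|^2. *)
Lemma row_sum_cvg x u : BH x ->
  cvgn (series (fun k => z k (x (adj ip (z k) u)))).
Proof.
move=> Bx; have [C C0 hC] := BH_bounded Bx.
apply: cauchy_rn => e e0.
have e1 : 0 < (e / C) ^+ 2 by rewrite exprn_gt0// divr_gt0.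
have := @sum_adj_rn2 u; move/cvgrPdist_lt/(_ _ e1) => [N _ hN].
exists N => m n /andP[Nn nm].
have /= := hN n Nn; rewrite ltr_norml => /andP[_ h].
have -> : series (fun k => z k (x (adj ip (z k) u))) m -
   series (fun k => z k (x (adj ip (z k) u))) n =
   \sum_(n <= k < m) z k (x (adj ip (z k) u)).
  by rewrite /series /= (big_cat_nat _ _ (n := n))//= addrAC subrr add0r.
rewrite -(@ltr_pXn2r _ 2) ?nnegrE ?rn_ge0//; last exact: ltW.
apply: le_lt_trans (row_contraction n m (fun k => x (adj ip (z k) u))) _.
apply: (@le_lt_trans _ _ (\sum_(n <= k < m) C ^+ 2 * rn (adj ip (z k) u) ^+ 2)).
  apply: ler_sum => k _; rewrite -exprMn ler_pXn2r ?nnegrE ?rn_ge0//.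
  by rewrite mulr_ge0 ?rn_ge0// ltW.
rewrite -mulr_sumr -ltr_pdivlMl ?exprn_gt0// mulrC -expr_div_n.
have := sum_adj_rn2_le m u; rewrite (big_cat_nat _ _ (n := n))//=; lra.
Qed.

End RowContraction.

Lemma cvg0_nneg_terms {R : realType} (f : nat -> R) : (forall k, 0 <= f k) ->
  \sum_(0 <= k < n) f k @[n --> \oo] --> (0 : R) -> forall k, f k = 0.
Proof.
move=> f0 h k; apply/eqP; rewrite eq_le f0 andbT.
have nd : {homo (fun n => \sum_(0 <= k < n) f k) : n m / (n <= m)%N >-> n <= m}.
  by apply/nondecreasing_seqP => m; rewrite big_nat_recr//= lerDl.
have := nondecreasing_cvgn_le nd (cvgP _ h) k.+1.
rewrite (cvg_lim (@Rhausdorff R) h) big_nat_recr//=.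
by apply: le_trans; rewrite lerDr sumr_ge0.
Qed.

(** * Standard form *)

Section StandardForm.
Context {R : realType} {H : completeNormedModType R[i]}.
Context {ip : {dot H for Num.conj}}.
Context {M : set (H -> H)} {tau : (H -> H) -> R[i]} {xi0 : H} {J : H -> H}.
Hypothesis hip : hilbert ip.
Hypothesis vM : von_neumann ip M.
Hypothesis htau : tracial_state ip M tau.
Hypothesis hL2 : is_L2 ip M tau xi0.
Hypothesis hJ : modular_conjugation ip M xi0 J.
Implicit Types (x y : H -> H) (u v w : H) (S T : H -> H).

Let MBH x : M x -> BH x. Proof. exact: von_neumann_BH vM x. Qed.

Let Madj x : M x -> M (adj ip x). Proof. by case: vM => + _; apply. Qed.

Let Mid : M idfun.
Proof. by case: vM => _ <-; apply: commutant_id; exact: commutant_BH. Qed.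

Let Mcomp x y : M x -> M y -> M (x \o y).
Proof. by case: vM => _ <-; exact: commutant_comp. Qed.

(** Reduces identities between continuous maps to the vectors x xi0 with x in M, which are dense in
    L^2(M). *)
Lemma dense_eq (f g : H -> H) : continuous f -> continuous g ->
  (forall x, M x -> f (x xi0) = g (x xi0)) -> f =1 g.
Proof.
move=> cf cg fg u; apply: (closure_eq_fun (A := [set x xi0 | x in M]) cf cg).
  by move=> _ [x Mx <-]; exact: fg.
by rewrite hL2.2.
Qed.

Lemma dense_orth u : (forall x, M x -> ip (x xi0) u = 0) -> u = 0.
Proof.
move=> h; apply/eqP; rewrite -(dnorm_eq0 ip); apply/eqP.
apply: (ip_closed hip) => e e0.
have : closure [set x xi0 | x in M] u by rewrite hL2.2.
by move=> /closure_rnP/(_ e e0)[_ [x Mx <-] ux]; exists (x xi0) => //; exact: h.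
Qed.

Lemma modularM x : M x -> J (x xi0) = adj ip x xi0.
Proof. exact: hJ.2. Qed.

Lemma modular_cont : continuous J. Proof. exact: hJ.1. Qed.

Lemma ip_tau x y : M x -> M y -> ip (x xi0) (y xi0) = tau (adj ip y \o x).
Proof. exact: hL2.1. Qed.

Lemma tau_comm x y : M x -> M y -> tau (x \o y) = tau (y \o x).
Proof. by case: htau => _ _ _; apply. Qed.

Lemma modular_rn u : rn (J u) = rn u.
Proof.
have hM x : M x -> rn (J (x xi0)) = rn (x xi0).
  move=> Mx; have := tau_comm Mx (Madj Mx).
  rewrite modularM// -ip_tau// -{1}(adjK hip (MBH Mx)) -ip_tau//; try exact: Madj.
  by rewrite !(ipE hip) => -[] /eqP; rewrite eqrXn2 ?rn_ge0// => /eqP.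
apply/eqP; rewrite eq_sym -subr_eq0 -normr_eq0 eq_le normr_ge0 andbT leNgt.
apply/negP => d0; set d := `|_| in d0.
have d2 : 0 < d / 2 by rewrite divr_gt0.
have := hJ.1 u; move/cvg_rnP/(_ _ d2) => h1.
have := @cvg_id _ (nbhs u); move/cvg_rnP/(_ _ d2) => h2.
have : closure [set x xi0 | x in M] u by rewrite hL2.2.
move=> /(_ _ (filterI h1 h2)) [_ [[x Mx <-] /= [h3 h4]]].
have a1 := rn_dist u (x xi0); have a2 := rn_dist (J (x xi0)) (J u).
rewrite (hM x Mx) (rnBC (J _)) in a2.
by have := ler_distD (rn (x xi0)) (rn u) (rn (J u)); rewrite -/d; lra.
Qed.

Lemma modularK u : J (J u) = u.
Proof.
move: u; apply: dense_eq => [u|u|x Mx].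
- exact: (continuous_comp (@modular_cont u) (@modular_cont (J u))).
- exact: cvg_id.
- rewrite modularM// modularM; last exact: Madj.
  by rewrite (adjK hip)//; exact: MBH.
Qed.

Let contD (f g : H -> H) : continuous f -> continuous g ->
  continuous (fun u => f u + g u).
Proof. by move=> cf cg u; apply: cvgD; [exact: cf|exact: cg]. Qed.

Let contZ a (f : H -> H) : continuous f -> continuous (fun u => a *: f u).
Proof. by move=> cf u; apply: cvgZ; [exact: cvg_cst|exact: cf]. Qed.

Let contC (u : H) : continuous (fun _ : H => u).
Proof. by move=> v; exact: cvg_cst. Qed.

Let contJ (f : H -> H) : continuous f -> continuous (fun u => J (f u)).
Proof.
by move=> cf u; apply: (continuous_comp (cf u)); exact: modular_cont.
Qed.

Let contI : continuous (fun u : H => u).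
Proof. by move=> u; exact: cvg_id. Qed.

Let Mlin (a : R[i]) x y : M x -> M y -> M (fun u => a *: x u + y u).
Proof. by case: vM => _ <-; apply: commutant_lin; exact: commutant_BH. Qed.

Lemma adj_lin (a : R[i]) x y : M x -> M y ->
  adj ip (fun u => a *: x u + y u) =
  (fun u => Num.conj a *: adj ip x u + adj ip y u).
Proof.
move=> Mx My; apply: (adj_unique hip) => [|u v]; first exact/MBH/Mlin.
rewrite ipDl ipZl ipDr ipZr conjCK (ip_adj hip); last exact: MBH.
by rewrite (ip_adj hip)//; exact: MBH.
Qed.

Lemma modular_lin (a : R[i]) u v : J (a *: u + v) = Num.conj a *: J u + J v.
Proof.
pose f v u := J (a *: u + v); pose g v u := Num.conj a *: J u + J v.
(* Density is used first in u and then in v; on M xi0 the identity is the conjugate-linearity of the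
   adjoint. *)
suff : f v =1 g v by apply.
apply: dense_eq => [||x Mx]; rewrite /f /g; [| |move: v].
- by apply/contJ/contD/contC; apply: contZ.
- by apply: contD => //; apply/contZ/contJ.
apply: dense_eq => [||y My].
- by apply/contJ/contD.
- by apply: contD => //; apply: contJ.
have := modularM (Mlin a Mx My); rewrite adj_lin// => ->.
by rewrite !modularM.
Qed.

Lemma modularD u v : J (u + v) = J u + J v.
Proof. by rewrite -[u]scale1r modular_lin rmorph1 !scale1r. Qed.

Lemma modular0 : J 0 = 0.
Proof. by apply: (@addIr _ (J 0)); rewrite -modularD !add0r. Qed.

Lemma modularZ a u : J (a *: u) = Num.conj a *: J u.
Proof. by rewrite -[a *: u]addr0 modular_lin modular0 addr0. Qed.

Lemma modularB u v : J (u - v) = J u - J v.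
Proof. by rewrite -scaleN1r addrC modular_lin rmorphN rmorph1 scaleN1r addrC. Qed.

Lemma modular_sum n m (f : nat -> H) :
  J (\sum_(n <= k < m) f k) = \sum_(n <= k < m) J (f k).
Proof.
by elim/big_rec2: _ => [|k x y _ <-]; [exact: modular0|rewrite modularD].
Qed.

(** Polarization: an additive isometry preserves Re <u, v>, and replacing v by iv, with J(iv) = -i
    Jv, reverses the sign of the imaginary part. *)
Lemma modular_ip u v : ip (J u) (J v) = ip v u.
Proof.
have hr w : rip ip (J u) (J w) = rip ip u w.
  have := rnD2 hip (J u) (J w); rewrite -modularD !modular_rn (rnD2 hip).
  by move=> h; lra.
have := hr v; have := hr ('i *: v); rewrite modularZ /rip !ipZr [ip v u]ipC.
case: (ip u v) => a b; case: (ip (J u) (J v)) => c d /=.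
rewrite !(mul0r, mul1r, mulNr, sub0r, opprK, mulN1r, oppr0, add0r, subr0, addr0).
by move=> <- ->; rewrite -[RHS]/(a -i* - d) opprK.
Qed.

Lemma modular_ipl u v : ip (J u) v = ip (J v) u.
Proof. by rewrite -{1}[v]modularK modular_ip. Qed.

Lemma modular_ipr u v : ip u (J v) = ip v (J u).
Proof. by rewrite -{1}[u]modularK modular_ip. Qed.

Lemma BH_conj T : BH T -> BH (J \o T \o J).
Proof.
move=> BT; split => [a u v /=|].
  by rewrite modular_lin BHlin// modular_lin conjCK.
apply: contJ => u.
exact: (continuous_comp (@modular_cont u) (BT.2 (J u))).
Qed.

Lemma adj_conj T : BH T -> adj ip (J \o T \o J) = J \o adj ip T \o J.
Proof.
move=> BT; apply: (adj_unique hip) => [|u v /=]; first exact: BH_conj.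
by rewrite modular_ipl -(ip_adjl hip)// modular_ipr.
Qed.

Lemma comp_conj S T : J \o (S \o T) \o J = (J \o S \o J) \o (J \o T \o J).
Proof. by apply/funext => u /=; rewrite !modularK. Qed.

(** * The commutation theorem M' = JMJ *)

Lemma modular_xi0 : J xi0 = xi0.
Proof.
rewrite -[xi0 in LHS]/(idfun xi0) modularM//.
by rewrite (adj_unique hip (T := idfun) (S := idfun)).
Qed.

(** JxJ sends z xi0 to z x^* xi0: it is right multiplication by x^*, which commutes with left
    multiplications. *)
Lemma commutant_conj x : M x -> commutant M (J \o x \o J).
Proof.
move=> Mx; split=> [|y My]; first exact/BH_conj/MBH.
apply/funext; apply: dense_eq => [||z Mz].
- move=> u; apply: (continuous_comp ((MBH My).2 u)).
  exact: ((BH_conj (MBH Mx)).2 (y u)).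
- move=> u; apply: (continuous_comp ((BH_conj (MBH Mx)).2 u)).
  exact: ((MBH My).2 _).
have Mad a b : M a -> M b -> J ((a \o adj ip b) xi0) = (b \o adj ip a) xi0.
  move=> Ma Mb; rewrite modularM; last exact/Mcomp/Madj.
  rewrite (adj_comp hip); [|exact: MBH|exact/MBH/Madj].
  by rewrite (adjK hip)//; exact: MBH.
rewrite /= (modularM Mz) -[y (z xi0)]/((y \o z) xi0) (modularM (Mcomp My Mz)).
rewrite -[x (adj ip (y \o z) _)]/((x \o adj ip (y \o z)) xi0).
rewrite Mad//; last exact: Mcomp.
by rewrite -[x (adj ip z _)]/((x \o adj ip z) xi0) Mad.
Qed.

Lemma commutant_trace_vector x T : M x -> commutant M T -> T (x xi0) = x (T xi0).
Proof. by move=> Mx [_ /(_ x Mx) h]; rewrite -[LHS]/((T \o x) xi0) h. Qed.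

Lemma conj_xi0 x : M x -> (J \o adj ip x \o J) xi0 = x xi0.
Proof.
move=> Mx; rewrite /= modular_xi0 modularM; last exact: Madj.
by rewrite (adjK hip)//; exact: MBH.
Qed.

(** Each z xi0 equals V xi0 with V = J z^* J in M', and V moves past x and y, so values at xi0
    determine values on M xi0. *)
Lemma separating x y : M x -> M y -> x xi0 = y xi0 -> x = y.
Proof.
move=> Mx My xy; apply/funext; apply: dense_eq => [||z Mz].
- exact: (MBH Mx).2.
- exact: (MBH My).2.
have Mz' := commutant_conj (Madj Mz).
by rewrite -(conj_xi0 Mz) -!(commutant_trace_vector _ Mz')// xy.
Qed.

(** Tested against x xi0 with x in M, both sides give <T x xi0, xi0> = <x T xi0, xi0>. *)
Lemma modular_commutant T : commutant M T -> J (T xi0) = adj ip T xi0.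
Proof.
move=> hT; have BT := hT.1.
apply/eqP; rewrite -subr_eq0; apply/eqP/dense_orth => x Mx.
apply/eqP; rewrite ipBr subr_eq0 modular_ipr (modularM Mx); apply/eqP.
by rewrite -!(ip_adj hip) ?(commutant_trace_vector Mx hT)//; exact: MBH.
Qed.

(** As M = M'', it suffices that JTJ commutes with M'. The argument of [commutant_conj] is repeated
    with M' in place of M. *)
Lemma conj_commutant T : commutant M T -> M (J \o T \o J).
Proof.
move=> hT; have [_ <-] := vM; split=> [|S hS]; first exact: BH_conj hT.1.
have hA : self_adjoint_set (ip := ip) (commutant M).
  by apply: (self_adjoint_commutant hip); exact: von_neumann_self_adjoint vM.
apply/funext; apply: dense_eq => [||y My].
- move=> u; apply: (continuous_comp (hS.1.2 u)).
  exact: ((BH_conj hT.1).2 (S u)).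
- move=> u; apply: (continuous_comp ((BH_conj hT.1).2 u)).
  exact: (hS.1.2 _).
(* V lies in M' and V xi0 = y xi0, so the dense vectors y xi0 are also reached from M'. *)
pose V := J \o adj ip y \o J.
have hV : commutant M V by exact/commutant_conj/Madj.
rewrite -(conj_xi0 My) -/V.
(* On M' xi0 the operator JTJ is right multiplication by T^*. *)
have hm A : commutant M A -> J (T (J (A xi0))) = A (adj ip T xi0).
  move=> hA'; rewrite (modular_commutant hA') -[T _]/((T \o adj ip A) xi0).
  rewrite modular_commutant; last by apply: commutant_comp => //; case/hA: hA'.
  rewrite (adj_comp hip); [|exact: hT.1|exact: BH_adj hA'.1].
  by rewrite (adjK hip)//; exact: hA'.1.
rewrite /= (hm V)// -[S (V xi0)]/((S \o V) xi0) hm//.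
exact: commutant_comp.
Qed.

(** * The fixed points of phi *)

Context {z : nat -> H -> H}.
Hypothesis hz : frakS ip M z.

Let Mz n : M (z n). Proof. by case: hz. Qed.

Let zBH n : BH (z n). Proof. exact: MBH. Qed.

Let P := vN_generated ip (range z).

Let e := jones_projection ip P xi0.

Lemma self_adjoint_frakS : self_adjoint_set (ip := ip) (range z).
Proof.
move=> _ [n _ <-]; split; first exact: zBH.
by case: hz => _ _ _ /(_ n)[k ->]; exists k.
Qed.

(** P is the bicommutant of the z_n, and a triple commutant collapses; commuting with P can thus be
    checked on the generators. *)
Lemma commutant_vN_frakS : commutant P = commutant (range z).
Proof.
rewrite /P (vN_generatedE hip self_adjoint_frakS); apply: tricommutant.
by move=> s /self_adjoint_frakS[].
Qed.

Lemma vN_frakS_von_neumann : von_neumann ip P.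
Proof.
rewrite /P (vN_generatedE hip self_adjoint_frakS).
exact/(commutant_von_neumann hip)/(self_adjoint_commutant hip)/self_adjoint_frakS.
Qed.

Lemma vN_frakS_sub : P `<=` M.
Proof. by apply: smallest_sub => // _ [n _ <-]; exact: Mz. Qed.

Lemma vN_frakS_gen n : P (z n).
Proof. by move=> N [_]; apply; exists n. Qed.

(** * The subspace L^2(P) and the Jones projection *)

Let K := L2 P xi0.

Let Plin (a : R[i]) x y : P x -> P y -> P (fun u => a *: x u + y u).
Proof.
by case: vN_frakS_von_neumann => _ <-; apply: commutant_lin; exact: commutant_BH.
Qed.

Let Pcomp x y : P x -> P y -> P (x \o y).
Proof. by case: vN_frakS_von_neumann => _ <-; exact: commutant_comp. Qed.

Let Pid : P idfun.
Proof.
by case: vN_frakS_von_neumann => _ <-; apply: commutant_id; exact: commutant_BH.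
Qed.

Let Padj x : P x -> P (adj ip x).
Proof. by case: vN_frakS_von_neumann => + _; apply. Qed.

Let KP x : P x -> K (x xi0).
Proof. by move=> Px; apply: subset_closure; exists x. Qed.

Let Kcl : closure K `<=` K.
Proof. by rewrite -(closure_id K).1//; exact: closed_closure. Qed.

Let Klin (a : R[i]) v w : K v -> K w -> K (a *: v + w).
Proof.
move=> Kv; move: w; apply: image_closure.
  by move=> u; apply: cvgD; [exact: cvg_cst|exact: cvg_id].
move=> _ [q Pq <-]; move: v Kv; apply: image_closure.
  move=> u; apply: cvgD; last exact: cvg_cst.
  by apply: cvgZ; [exact: cvg_cst|exact: cvg_id].
by move=> _ [p Pp <-]; apply: KP (Plin a Pp Pq).
Qed.

Let K0 : K 0.
Proof. by have := @Klin (-1) _ _ (KP Pid) (KP Pid); rewrite scaleN1r addNr. Qed.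

Let KJ w : K w -> K (J w).
Proof.
move: w; apply: image_closure => [|_ [p Pp <-]]; first exact: hJ.1.
rewrite modularM; last exact: vN_frakS_sub.
by apply: KP; exact: Padj.
Qed.

Let BHe : BH e. Proof. exact: orth_proj_BH. Qed.

Let Me : set (H -> H) := M `|` [set e].

Lemma self_adjoint_Me : self_adjoint_set (ip := ip) Me.
Proof.
move=> T [MT|->].
  by have [] := von_neumann_self_adjoint vM MT; split=> //; left.
by split=> //; right; exact: adj_orth_proj.
Qed.

Lemma basic_extensionE : basic_extension ip M P xi0 = commutant (commutant Me).
Proof. exact: (vN_generatedE hip self_adjoint_Me). Qed.

(** [J] preserves L^2(P) because P is closed under adjoints, and it serves as its own adjoint up to
    conjugation of the inner product. *)
Lemma modular_jones : J \o e = e \o J.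
Proof.
apply: (orth_proj_commute hip K0 Kcl Klin (T' := J)) => // [u v|u w].
  exact: modularB.
by move=> h; rewrite modular_ipl ipC h rmorph0.
Qed.

Let Kconj p w : P p -> K w -> K (J (p (J w))).
Proof.
move=> Pp /KJ Kw; apply/KJ; move: Kw; move: (J w); apply: image_closure.
  exact: (von_neumann_BH vM (vN_frakS_sub Pp)).2.
by move=> _ [q Pq <-]; apply: KP (Pcomp Pp Pq).
Qed.

(** JpJ lies in M', and both it and its adjoint J p^* J leave L^2(P) invariant, hence it commutes
    with e_P. *)
Lemma conj_commutant_Me p : P p -> commutant Me (J \o p \o J).
Proof.
move=> Pp; have Mp := vN_frakS_sub Pp.
have hc := commutant_conj Mp.
split; first by case: hc.
move=> T [MT|->]; first by case: hc => _; apply.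
have Bp := von_neumann_BH vM Mp.
have BJ := BH_conj Bp.
apply: (orth_proj_commute hip K0 Kcl Klin (T' := J \o adj ip p \o J)).
- by move=> u v; exact: BHB.
- by move=> u w; rewrite (ip_adj hip _ _ BJ) adj_conj.
- by move=> w; exact: Kconj.
- by move=> w; apply: Kconj; exact: Padj.
Qed.

(** * The three inclusions *)

Let Ad_conjE n T : Ad ip (J \o z n \o J) T =
  (J \o z n \o J) \o T \o (J \o adj ip (z n) \o J).
Proof. by rewrite /Ad adj_conj. Qed.

Lemma conj_commutant_sub_basic :
  conj_by J (commutant P `&` M) `<=` commutant M `&` basic_extension ip M P xi0.
Proof.
move=> _ [x [[Bx hx] Mx] <-]; have hJx := commutant_conj Mx.
split=> //; rewrite basic_extensionE; split; first by case: hJx.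
move=> T [BT hT].
have cT : commutant M T by split=> // s Ms; apply: hT; left.
pose y := J \o T \o J.
have My : M y := conj_commutant cT.
have Te : T \o e = e \o T by apply: hT; right.
(* Both [J] and T commute with e_P, hence so does y; since e_P fixes xi0, this puts y xi0 in
   L^2(P). *)
have ye : y (e xi0) = e (y xi0).
  rewrite /y /=; have JE u : J (e u) = e (J u).
    by rewrite -[LHS]/((J \o e) u) modular_jones.
  by rewrite JE -[T (e _)]/((T \o e) _) Te /= JE.
have Kxi : K xi0 by exact: (KP Pid).
have Ky : K (y xi0).
  rewrite -(orth_proj_id hip K0 Kcl Klin Kxi) -/e ye.
  by have [] := orth_projP hip K0 Kcl Klin (y xi0).
have hJa := commutant_conj (Madj Mx).
(* At p xi0 with p in P, the right side is p x xi0, which equals x p xi0 because x commutes with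
   p. *)
have xv v : K v -> x v = (J \o adj ip x \o J) v.
  move: v; apply: closure_eq_fun; [exact: Bx.2|exact: hJa.1.2|].
  move=> _ [p Pp <-].
  rewrite (commutant_trace_vector _ hJa); last exact: vN_frakS_sub.
  rewrite (conj_xi0 Mx) -[x (p xi0)]/((x \o p) xi0).
  by rewrite hx.
(* At xi0: x y xi0 = J x^* J y xi0 = y J x^* J xi0 = y x xi0. *)
have xy : x \o y = y \o x.
  apply: separating; [exact: Mcomp|exact: Mcomp|].
  rewrite /= (xv _ Ky) (commutant_trace_vector My hJa).
  by rewrite (conj_xi0 Mx).
have Ty : T = J \o y \o J by apply/funext => u; rewrite /y /= !modularK.
by rewrite Ty -!comp_conj xy.
Qed.

Lemma basic_sub_fixed :
  commutant M `&` basic_extension ip M P xi0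
  `<=` commutant M `&` BH_fixed (phi ip J z).
Proof.
move=> T [cT]; rewrite basic_extensionE => -[BT hT]; split=> //; split=> //.
apply/funext => u; rewrite /phi; apply: (cvg_lim (@norm_hausdorff _ H)).
have Tz n v : T (J (z n (J v))) = J (z n (J (T v))).
  have /hT h := conj_commutant_Me (vN_frakS_gen n).
  by rewrite -[LHS]/((T \o (J \o z n \o J)) v) h.
(* As T commutes with each J z_n J, the continuous map TJ factors out of the partial sums, leaving
   those of z_n z_n^* at Ju, which tend to Ju. *)
have -> : series (fun n => Ad ip (J \o z n \o J) T u) =
    (T \o J) \o series (fun n => (z n \o adj ip (z n)) (J u)).
  apply/funext => n; rewrite /series /= modular_sum.
  rewrite (BH_sum _ _ _ BT); apply: eq_bigr => k _.
  by rewrite Ad_conjE /= -Tz modularK.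
have hs := let: And4 _ hs _ _ := hz in hs (J u).
rewrite -[u in X in _ --> X]modularK -[T (J _)]/((T \o J) _).
apply: (continuous_cvg _ _ hs).
exact: (continuous_comp (hJ.1 _) (BT.2 _)).
Qed.

Lemma fixed_sub_conj_commutant :
  commutant M `&` BH_fixed (phi ip J z) `<=` conj_by J (commutant P `&` M).
Proof.
move=> T [cT [BT fT]]; pose x := J \o T \o J.
have Mx : M x := conj_commutant cT.
have Bx := von_neumann_BH vM Mx.
have TE : J \o x \o J = T by apply/funext => u; rewrite /x /= !modularK.
exists x => //; split=> //; rewrite commutant_vN_frakS; split=> //.
have [_ hs1 hs2 hadj] := hz.
pose a k := adj ip (z k).
(* The family is closed under adjoints, so commuting with every z_k^* suffices. *)
suff xa k : x \o a k = a k \o x.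
  move=> _ [n _ <-]; have [k nk] := hadj n.
  by have := xa k; rewrite /a -nk (adjK hip).
have Ma n : M (a n) by exact: Madj.
apply: separating; [exact: Mcomp|exact: Mcomp|].
pose A := series (fun k => z k (x (a k xi0))).
have AT : A @ \oo --> x xi0.
  (* [limn] has a default value on divergent sequences, so convergence must be proved before phi T =
     T can identify the limit. *)
  have /cvg_ex[l Al] : cvgn A := row_sum_cvg hip zBH hs1 (u := xi0) Bx.
  suff -> : x xi0 = l by [].
  have JA : J \o A @ \oo --> J l.
    by apply: (continuous_cvg _ _ Al); exact: hJ.1.
  have := congr1 (@^~ xi0) fT; rewrite /phi.
  have -> : series (fun n => Ad ip (J \o z n \o J) T xi0) = J \o A.
    apply/funext => n; rewrite /A /series /= modular_sum.
    apply: eq_bigr => i _.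
    by rewrite Ad_conjE /= modular_xi0.
  rewrite (cvg_lim (@norm_hausdorff _ H) JA) => JlT.
  by rewrite /x /= modular_xi0 -JlT modularK.
pose f k := rn (x (a k xi0) - a k (x xi0)) ^+ 2.
suff fk : f k = 0.
  apply/eqP; rewrite -subr_eq0; apply/eqP/rn_eq0/eqP.
  by rewrite -sqrf_eq0; apply/eqP.
apply: cvg0_nneg_terms => [n|]; first exact: sqr_ge0.
have aBH n : BH (a n) by exact: BH_adj.
have aK n : adj ip (a n) = z n by exact: adjK.
(* The sum of z_n^* z_n being 1 makes the adjoints a row of the same kind; [c1] then sums |z_k J x
   xi0|^2 to |J x xi0|^2. *)
have hs2' : SOT_sum_to (fun n => a n \o adj ip (a n)) idfun.
  by under eq_fun do rewrite aK.
have c1 := sum_adj_rn2 hip aBH hs2' (u := J (x xi0)).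
have c2 := sum_adj_rn2 hip zBH hs1 (u := x xi0).
have c3 := cvg_rip hip (v := x xi0) AT.
rewrite modular_rn in c1; rewrite (ripE hip) in c3.
have c4 : 2 * rip ip (A n) (x xi0) @[n --> \oo] --> 2 * rn (x xi0) ^+ 2.
  by apply: cvgM; [exact: cvg_cst|exact: c3].
have fE n : \sum_(0 <= k < n) f k =
    \sum_(0 <= k < n) rn (adj ip (a k) (J (x xi0))) ^+ 2
    - 2 * rip ip (A n) (x xi0)
    + \sum_(0 <= k < n) rn (adj ip (z k) (x xi0)) ^+ 2.
  rewrite /A /series /= rip_suml mulr_sumr -sumrB -big_split /=.
  apply: eq_bigr => i _; rewrite /f (rnB2 hip); congr (_ - _ * _ + _).
    (* Here z_i^* xi0 = J z_i J xi0, and J z_i J in M' moves past x. *)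
    have -> : x (a i xi0) = J (z i (J (x xi0))).
      have hc := commutant_conj (Mz i).
      rewrite -[RHS]/((J \o z i \o J) (x xi0)) (commutant_trace_vector Mx hc) /=.
      by rewrite modular_xi0 modularM.
    by rewrite modular_rn aK.
  by rewrite /rip (ip_adj hip _ _ (zBH i)).
under eq_fun do rewrite fE.
have c0 := cvgD (cvgB c1 c4) c2.
(* All three limits are multiples of |x xi0|^2, with coefficients 1, -2 and 1. *)
have l0 : rn (x xi0) ^+ 2 - 2 * rn (x xi0) ^+ 2 + rn (x xi0) ^+ 2 = 0 by ring.
rewrite l0 in c0.
exact: c0.
Qed.

End StandardForm.

Unset Implicit Arguments.

Theorem theorem2p3 (R : realType) (H : completeNormedModType R[i])
  (ip : {dot H for Num.conj}) (M : set (H -> H)) (tau : (H -> H) -> R[i])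
  (xi0 : H) (J : H -> H) (z : nat -> H -> H) (P : set (H -> H)) :
  hilbert ip ->
  II1_factor ip M ->
  tracial_state ip M tau ->
  is_L2 ip M tau xi0 ->
  modular_conjugation ip M xi0 J ->
  frakS ip M z ->
  P = vN_generated ip (range z) ->
  commutant M `&` BH_fixed (phi ip J z)
    = commutant M `&` basic_extension ip M P xi0 /\
  commutant M `&` basic_extension ip M P xi0
    = conj_by J (commutant P `&` M).
Proof.
move=> hip [[vM _] _ _] htau hL2 hJ hz ->.
have h1 := conj_commutant_sub_basic hip vM htau hL2 hJ hz.
have h2 := basic_sub_fixed hip vM htau hL2 hJ hz.
have h3 := fixed_sub_conj_commutant hip vM htau hL2 hJ hz.
split; apply/seteqP; split=> //.
- exact: subset_trans h3 h1.
- exact: subset_trans h2 h3.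
Qed.
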